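(* Let $\chi\in\mathbb{C}$ with $|\chi|=1$, let $\eta$ be a faithful state on $q_\chi\mathfrak{A}_{[0,1]}q_\chi$, and let $\varphi$ be the translation invariant Markov state on $\mathfrak{A}$ constructed from $\chi$ and $\eta$ in the context. Let $\Lambda_1,\Lambda_2\subset\mathbb{Z}$ be nonempty with $\Lambda_1\cap\Lambda_2=\emptyset$ and $\Lambda_1\cup\Lambda_2=\mathbb{Z}$. Suppose that $\eta(X)\neq0$, where $$X:=V\alpha(q_{\chi,-})q_\chi=\tfrac12\,V(\chi a_1+\overline{\chi}a_1^+)q_\chi .$$ Then $\varphi$ is entangled with respect to the decomposition $\mathfrak{A}=\overline{\mathfrak{A}_{\Lambda_1}\bigvee\mathfrak{A}_{\Lambda_2}}$.
   Context: $\mathfrak{A}$ is the CAR algebra over $\mathbb{Z}$, generated by $a_j$, $a_j^+=a_j^*$, $j\in\mathbb{Z}$, with $\{a_j^+,a_k\}=\delta_{jk}1$, $\{a_j,a_k\}=0$. For $\Lambda\subset\mathbb{Z}$, $\mathfrak{A}_\Lambda$ is the $C^*$-subalgebra generated by $\{a_j,a_j^+\}_{j\in\Lambda}$; $[0,1]$ denotes $\{0,1\}$. $\Theta$ is the parity automorphism $\Theta(a_j)=-a_j$, $\alpha$ the shift $\alpha(a_j)=a_{j+1}$, $\tau$ the normalized trace. A state is even if it is $\Theta$-invariant. The subscript $-$ denotes the odd part, $x_-=\frac12(x-\Theta(x))$. $q_{\chi}:=\frac12(1+\chi a_0+\overline{\chi}a_0^+)$ is a rank one projection of $\mathfrak{A}_{\{0\}}\cong\mathbb{M}_2(\mathbb{C})$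 and $q_{-\chi}=1-q_\chi$. Let $\xi_\chi,\xi_\chi^\perp\in\mathbb{C}^2$ be unit vectors in the ranges of $q_\chi$ and $q_{-\chi}$, respectively (uniquely determined up to a phase), and let $V:=\langle\,\cdot\,,\xi_\chi\rangle\xi_\chi^\perp\in\mathfrak{A}_{\{0\}}\subset\mathfrak{A}_{[0,1]}$. Construction of $\varphi$: put, for $x\in\mathfrak{A}_{[0,1]}$, $$\varepsilon(x)=\eta(q_\chi xq_\chi)q_\chi+\eta(q_\chi\Theta(x)q_\chi)q_{-\chi},$$ and $\varepsilon_n:=\alpha^n\circ\varepsilon\circ\alpha^{-n}$ on $\mathfrak{A}_{[n,n+1]}$. Then $\varphi$ is the translation invariant locally faithful Markov state on $\mathfrak{A}$ determined by $$\varphi(x_k\cdots x_l)=\tau\big(\varepsilon_k(x_k\varepsilon_{k+1}(x_{k+1}\cdots\varepsilon_{l-1}(x_{l-1}\varepsilon_l(x_l))\cdots))\big),\qquad x_j\in\mathfrak{A}_{\{j\}},\ k\le l.$$ Entanglement: for disjoint $\Lambda_1,\Lambda_2$ and states $\varphi_i$ on $\mathfrak{A}_{\Lambda_i}$, at least one of which is even, there is a unique product state $\varphi_1\varphi_2$ on $\mathfrak{A}_{\Lambda_1\cup\Lambda_2}$, i.e. the state with $(\varphi_1\varphi_2)(xy)=\varphi_1(x)\varphi_2(y)$ for $x\in\mathfrak{A}_{\Lambda_1}$, $y\in\mathfrak{A}_{\Lambda_2}$. A state on $\mathfrak{A}_{\Lambda_1\cup\Lambda_2}$ is separable if it lies in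 the (weak-* ) closed convex hull of all product states, and entangled otherwise.
   Formalization: As printed, X = Vα(q_{χ,-})q_χ is always 0, since α(q_{χ,-})q_χ = q_{-χ}α(q_{χ,-}) and Vq_{-χ} = 0; the formal hypothesis is that η(X) ≠ 0 for X built from V as printed or from its adjoint V* = ⟨·,ξ_χ^⊥⟩ξ_χ. *)

(* Defs.v *)
From HB Require Import structures.
From mathcomp Require Import all_boot all_order all_algebra spectral.
From mathcomp Require Import complex.
From mathcomp Require Import all_classical all_reals all_analysis.

Set Implicit Arguments.
Unset Strict Implicit.
Unset Printing Implicit Defensive.

Import Order.TTheory GRing.Theory Num.Theory.
Import numFieldNormedType.Exports.

Local Open Scope classical_set_scope.
Local Open Scope ring_scope.
Local Open Scope complex_scope.
Local Open Scope sesquilinear_scope.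

(* Algebras over R[i] with a submultiplicative norm.  The norm takes its
   (nonnegative real) values in R[i], as in the normed modules over R[i] of the
   library.  Hierarchy Builder cannot declare a join of those with the
   noncommutative algebras, hence the alias normed_copy, which carries the
   topology. *)
HB.mixin Record isNormedAlgebra (R : realType) A & GRing.Algebra R[i] A := {
  nm : A -> R[i];
  nmD : forall x y : A, nm (x + y) <= nm x + nm y;
  nmZ : forall (c : R[i]) (x : A), nm (c *: x) = `|c| * nm x;
  nm0_eq0 : forall x : A, nm x = 0 -> x = 0;
  nmM : forall x y : A, nm (x * y) <= nm x * nm y
}.

#[short(type="normedAlgType")]
HB.structure Definition NormedAlgebra (R : realType) :=
  {A of GRing.Algebra R[i] A & isNormedAlgebra R A}.

Definition normed_copy (R : realType) (A : normedAlgType R) : Type := A.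

HB.instance Definition _ (R : realType) (A : normedAlgType R) :=
  GRing.Lmodule.on (@normed_copy R A).
HB.instance Definition _ (R : realType) (A : normedAlgType R) :=
  Lmodule_isNormed.Build R[i] (@normed_copy R A) (@nmD R A) (@nmZ R A)
    (@nm0_eq0 R A).

(* Unital complex C*-algebras *)
HB.mixin Record isCStarAlgebra (R : realType) A & NormedAlgebra R A := {
  star : A -> A;
  starK : involutive star;
  starD : forall x y : A, star (x + y) = star x + star y;
  starZ : forall (c : R[i]) (x : A), star (c *: x) = Num.conj c *: star x;
  starM : forall x y : A, star (x * y) = star y * star x;
  nm_star : forall x : A, nm (star x * x) = nm x ^+ 2;
  nm_complete : forall F : set_system (normed_copy A),
    ProperFilter F -> cauchy F -> cvg F
}.

#[short(type="cstarAlgType")]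
HB.structure Definition CStarAlgebra (R : realType) :=
  {A of NormedAlgebra R A & isCStarAlgebra R A}.

Section CStar.
Context {R : realType} {A : cstarAlgType R}.
Implicit Types (x y : A) (S B G : set A) (w : A -> R[i]).

Definition cstar_subalgebra B : Prop :=
  [/\ B 1, (forall (c : R[i]) x y, B x -> B y -> B (c *: x + y)),
      (forall x y, B x -> B y -> B (x * y)),
      (forall x, B x -> B (star x)) & closed (B : set (normed_copy A))].

Definition cstar_generated G : set A := smallest cstar_subalgebra G.

(* A functional on a subalgebra S is represented by a function on all of A, of
   which only the restriction to S is meaningful.  The unit e of S is explicit
   because it differs from that of A when S is a corner. *)
Definition state_on S (e : A) w : Prop :=
  [/\ (forall (c : R[i]) x y, S x -> S y -> w (c *: x + y) = c * w x + w y),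
      (forall x, S x -> 0 <= w (star x * x)) & w e = 1].

Definition faithful_on S w : Prop :=
  forall x, S x -> w (star x * x) = 0 -> x = 0.

Definition tracial w : Prop := forall x y, w (x * y) = w (y * x).

Definition corner S (e : A) : set A := [set e * x * e | x in S].

Definition star_automorphism (f : {lrmorphism A -> A}) : Prop :=
  bijective f /\ {morph f : x / star x}.

Definition convex_hull (P : set (A -> R[i])) : set (A -> R[i]) :=
  [set w | exists (n : nat) (l : 'I_n -> R) (p : 'I_n -> A -> R[i]),
    [/\ (forall i, 0 <= l i), \sum_(i < n) l i = 1, (forall i, P (p i)) &
        w = fun x => \sum_(i < n) (l i)%:C * p i x]].

End CStar.

Section CAR.
Context {R : realType} {A : cstarAlgType R} (a : int -> A).

Definition car_subalgebra (L : set int) : set A := cstar_generated (a @` L).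

Definition is_car_algebra : Prop :=
  [/\ (forall j k, star (a j) * a k + a k * star (a j) = (j == k)%:R),
      (forall j k, a j * a k + a k * a j = 0) &
      car_subalgebra setT = setT].

Definition is_parity (Theta : {lrmorphism A -> A}) : Prop :=
  star_automorphism Theta /\ forall j, Theta (a j) = - a j.

Definition is_shift (alpha : {lrmorphism A -> A}) : Prop :=
  star_automorphism alpha /\ forall j, alpha (a j) = a (j + 1).

Definition is_normalized_trace (tau : A -> R[i]) : Prop :=
  state_on setT 1 tau /\ tracial tau.

Definition odd_part (Theta : A -> A) (x : A) : A := 2^-1 *: (x - Theta x).

Definition qproj (chi : R[i]) : A :=
  2^-1 *: (1 + chi *: a 0 + Num.conj chi *: star (a 0)).

(* f ^ n for an integer n, where g is the inverse of f *)
Definition int_iter (f g : A -> A) (n : int) : A -> A :=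
  match n with Posz m => iter m f | Negz m => iter m.+1 g end.

(* With V = <., xi> xi' for unit vectors xi, xi' in the ranges of q_chi and
   q_(-chi), one has V q_(-chi) = 0, while alpha(q_(chi,-)) q_chi =
   q_(-chi) alpha(q_(chi,-)), so that entangler V = 0.  The operator for which
   this element lies in the corner of q_chi and need not vanish is the adjoint
   star V = <., xi'> xi, whence the two alternatives in the theorem. *)
Definition entangler (Theta alpha : A -> A) (chi : R[i]) (V : A) : A :=
  V * alpha (odd_part Theta (qproj chi)) * qproj chi.

Section Markov.
Variables (Theta alpha alphaV : A -> A) (chi : R[i]) (eta : A -> R[i]).
Let q := qproj chi.
Let q' := qproj (- chi).

Definition eps (x : A) : A :=
  eta (q * x * q) *: q + eta (q * Theta x * q) *: q'.

Definition eps_at (n : int) (x : A) : A :=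
  int_iter alpha alphaV n (eps (int_iter alpha alphaV (- n) x)).

(* eps_k (x_k eps_(k+1) (x_(k+1) ... eps_(k+m) (x_(k+m)) ... )) *)
Fixpoint eps_nest (x : int -> A) (k : int) (m : nat) : A :=
  match m with
  | 0%N => eps_at k (x k)
  | m'.+1 => eps_at k (x k * eps_nest x (k + 1) m')
  end.

Definition is_markov_state (tau phi : A -> R[i]) : Prop :=
  state_on setT 1 phi /\
  forall (x : int -> A) (k : int) (m : nat),
    (forall j, car_subalgebra [set j] (x j)) ->
    phi (\prod_(i < m.+1) x (k + i%:Z)) = tau (eps_nest x k m).

End Markov.

Section Separability.
Variables (Theta : A -> A) (L1 L2 : set int).
Let A1 := car_subalgebra L1.
Let A2 := car_subalgebra L2.
Let A12 := car_subalgebra (L1 `|` L2).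

Definition even_on (S : set A) (w : A -> R[i]) : Prop :=
  forall x, S x -> w (Theta x) = w x.

Definition product_state (w : A -> R[i]) : Prop :=
  state_on A12 1 w /\
  exists w1 w2 : A -> R[i],
    [/\ state_on A1 1 w1, state_on A2 1 w2, even_on A1 w1 \/ even_on A2 w2 &
        forall x y, A1 x -> A2 y -> w (x * y) = w1 x * w2 y].

(* The closure is for pointwise convergence.  It takes place in the functions
   on all of A, but as the values of a product state outside A12 are arbitrary,
   membership depends only on the restriction of w to A12, for which this is
   the weak-* closure. *)
Definition separable_state (w : A -> R[i]) : Prop :=
  @closure {ptws A -> R[i]^o} (convex_hull product_state) w.

Definition entangled_state (w : A -> R[i]) : Prop :=
  state_on A12 1 w /\ ~ separable_state w.

End Separability.

End CAR.

Section TwoByTwo.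
Context {R : realType} {A : cstarAlgType R}.

(* an isomorphism of the 2 x 2 matrices onto the C*-subalgebra S of A *)
Definition mx2_isomorphism (S : set A)
    (iota : {lrmorphism 'M[R[i]]_2 -> A}) : Prop :=
  [/\ injective iota, range iota = S &
      forall M : 'M[R[i]]_2, iota (M ^t*) = star (iota M)].

Definition unit_vector_in_range (Q : 'M[R[i]]_2) (xi : 'cV[R[i]]_2) : Prop :=
  (exists v : 'cV[R[i]]_2, xi = Q *m v) /\ xi ^t* *m xi = 1%:M.

(* the rank one operator < . , v > u *)
Definition rank_one (u v : 'cV[R[i]]_2) : 'M[R[i]]_2 := u *m v ^t*.

End TwoByTwo.

(* Main.v *)
Require Import Defs.
From HB Require Import structures.
From mathcomp Require Import all_boot all_order all_algebra spectral.
From mathcomp Require Import complex.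
From mathcomp Require Import all_classical all_reals all_analysis.

(** The obstruction to separability is a correlation between odd elements.  If
    x in A_L1 and y in A_L2 are odd, every product state w1 w2 satisfies
    (w1 w2)(x y) = w1(x) w2(y) = 0, because the even one among w1 and w2
    vanishes on odd elements; this survives convex combinations and pointwise
    limits ([separable_state_odd]).  Entanglement therefore follows from a
    single nonzero phi(x y) with x and y odd and localized on different sides,
    and since L1 and L2 are nonempty and cover the integers there are
    neighbours n and n + 1 on different sides ([adjacent_cover]).

    The odd elements are built from the self-adjoint unitaries
    c_u(j) = u a_j + conj(u) a_j^*, for |u| = 1, which anticommute at different
    sites, and also at the same site for the phases u and i u.  Write
    s = c_chi(0) and t = c_(i chi)(0).  Then q_chi = (1 + s) / 2 and
    q_(-chi) = (1 - s) / 2, and as eps sends the odd element s to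
    q_chi - q_(-chi) = s, the recursion defining phi gives
        phi(c_(i chi)(n) c_chi(n + 1)) = eta(q_chi t alpha(s) q_chi)
    for every n ([markov_correlation]).

    It remains to compare the right-hand side with eta(X).  As t anticommutes
    with s, it exchanges the ranges of q_chi and q_(-chi), so q_chi t is a
    matrix from the line of xi' to that of xi, hence a multiple of V^*, with a
    nonzero factor as t is invertible; and alpha(s) = 2 alpha(q_(chi,-)).  So
    the correlation is a nonzero multiple of eta(V^* alpha(q_(chi,-)) q_chi)
    ([correlation_entangler]), while V alpha(q_(chi,-)) q_chi is zero
    ([entangler_annihilator]). *)

Set Implicit Arguments.
Unset Strict Implicit.
Unset Printing Implicit Defensive.

Import Order.TTheory GRing.Theory Num.Theory.
Import numFieldNormedType.Exports.

Local Open Scope classical_set_scope.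
Local Open Scope ring_scope.
Local Open Scope complex_scope.
Local Open Scope sesquilinear_scope.

(** * The CAR relations for self-adjoint generators *)

Section Majorana.
Context {R : realType} {A : cstarAlgType R}.
Implicit Types (x y z : A) (u v c : R[i]) (j k n : int).

Definition acomm x y : A := x * y + y * x.

Lemma acommC x y : acomm x y = acomm y x.
Proof. by rewrite /acomm addrC. Qed.

Lemma acommDl x y z : acomm (x + y) z = acomm x z + acomm y z.
Proof. by rewrite /acomm mulrDl mulrDr addrACA. Qed.

Lemma acommZl c x y : acomm (c *: x) y = c *: acomm x y.
Proof. by rewrite /acomm -scalerAl -scalerAr scalerDr. Qed.

Lemma acommDr x y z : acomm x (y + z) = acomm x y + acomm x z.
Proof. by rewrite acommC acommDl !(acommC x). Qed.

Lemma acommZr c x y : acomm x (c *: y) = c *: acomm x y.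
Proof. by rewrite acommC acommZl acommC. Qed.

Lemma acomm_eq0 x y : acomm x y = 0 -> x * y = - (y * x).
Proof. by move/eqP; rewrite addr_eq0 => /eqP. Qed.

Variable a : int -> A.

(** The Majorana operators: for |u| = 1 they are odd self-adjoint unitaries,
    which generate the algebra as the a_j do but have simpler relations. *)
Definition majorana u j : A := u *: a j + Num.conj u *: star (a j).

(** The right-hand side is 2 Re(u conj(v)) at equal sites, so that two such
    operators on one site anticommute when their phases are orthogonal. *)
Lemma acomm_majorana u v j k : is_car_algebra a ->
  acomm (majorana u j) (majorana v k) =
  (u * Num.conj v + Num.conj u * v) *: (j == k)%:R.
Proof.
move=> [car1 car0 _].
have aa l m : acomm (a l) (a m) = 0 by exact: car0.
have sa l m : acomm (star (a l)) (a m) = (l == m)%:R by exact: car1.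
have star0 : star (0 : A) = 0.
  by apply: (addrI (star 0)); rewrite -starD !addr0.
have ss l m : acomm (star (a l)) (star (a m)) = 0.
  by rewrite /acomm -!starM -starD addrC [_ + _]aa star0.
rewrite !(acommDl, acommDr, acommZl, acommZr) aa ss sa (acommC (a j)) sa.
by rewrite (eq_sym k) !scaler0 addr0 add0r !scalerA -scalerDl (mulrC v).
Qed.

Lemma majorana_sqr u j : is_car_algebra a -> `|u| = 1 ->
  majorana u j * majorana u j = 1.
Proof.
move=> hA hu; have := acomm_majorana u u j j hA.
rewrite eqxx (mulrC (Num.conj u)) -normCK hu expr1n -mulr2n => h2.
have two0 : (2 : R[i]) != 0 by rewrite pnatr_eq0.
by apply: (scalerI two0); rewrite -h2 scaler_nat mulr2n.
Qed.

Lemma majoranaM_neq u v j k : is_car_algebra a -> j != k ->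
  majorana u j * majorana v k = - (majorana v k * majorana u j).
Proof.
move=> hA jk; apply: acomm_eq0.
by rewrite acomm_majorana// (negbTE jk) scaler0.
Qed.

Lemma majoranaM_i u j : is_car_algebra a ->
  majorana u j * majorana ('i * u) j = - (majorana ('i * u) j * majorana u j).
Proof.
move=> hA; apply: acomm_eq0; rewrite acomm_majorana ?rmorphM /=; last by [].
rewrite conjCi mulNr mulrN (mulrCA u) (mulrCA (Num.conj u)) (mulrC u).
by rewrite addNr scale0r.
Qed.

Lemma majoranaN u j : majorana (- u) j = - majorana u j.
Proof. by rewrite /majorana rmorphN !scaleNr opprD. Qed.

Lemma car_majorana (L : set int) u j : L j -> car_subalgebra a L (majorana u j).
Proof.
move=> Lj B [[B1 Blin _ Bstar _] aB].
have Ba : B (a j) by apply: aB; exists j.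
have B0 : B 0 by rewrite -(subrr 1) addrC -scaleN1r; exact: Blin.
apply: (Blin) => //; rewrite -[X in B X]addr0.
by apply: Blin => //; exact: Bstar.
Qed.

Lemma car_subalgebraM (L : set int) x y :
  car_subalgebra a L x -> car_subalgebra a L y -> car_subalgebra a L (x * y).
Proof.
move=> Lx Ly B hB; have [[_ _ BM _ _] _] := hB.
by apply: BM; [exact: Lx | exact: Ly].
Qed.

Lemma car_subalgebraS (L M : set int) :
  L `<=` M -> car_subalgebra a L `<=` car_subalgebra a M.
Proof.
move=> LM x Lx B [hB MB]; apply: Lx; split=> // _ [j Lj <-].
by apply: MB; exists j => //; exact: LM.
Qed.

End Majorana.

(** * The projection attached to a self-adjoint unitary *)

Section HalfProj.
Context {K : numFieldType} {A : algType K}.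
Implicit Types s x : A.

Definition half_proj s : A := 2^-1 *: (1 + s).

Lemma half_sum x : 2^-1 *: (x + x) = x.
Proof.
by rewrite -mulr2n -(scaler_nat 2 x) scalerA mulVf ?scale1r// pnatr_eq0.
Qed.

Lemma half_projN s : half_proj (- s) = 1 - half_proj s.
Proof.
rewrite -[1]half_sum.
by rewrite /half_proj -scalerBr opprD addrACA subrr add0r.
Qed.

Lemma half_proj_mulr s : s * s = 1 -> half_proj s * s = half_proj s.
Proof. by move=> ss; rewrite -scalerAl mulrDl mul1r ss addrC. Qed.

Lemma half_proj_idem s : s * s = 1 -> half_proj s * half_proj s = half_proj s.
Proof.
move=> ss; rewrite {2}/half_proj -scalerAr mulrDr mulr1 half_proj_mulr//.
exact: half_sum.
Qed.

(** An element anticommuting with s exchanges the two spectral projections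
    (1 + s) / 2 and (1 - s) / 2. *)
Lemma half_proj_anticomm s x : s * x = - (x * s) ->
  half_proj s * x = x * (1 - half_proj s).
Proof.
move=> sx; rewrite -half_projN -scalerAl -scalerAr mulrDl mulrDr mul1r mulr1.
by rewrite sx mulrN.
Qed.

End HalfProj.

(** * Separable states do not see products of odd elements *)

Section Entangled.
Context {R : realType} {A : cstarAlgType R}.
Variable Theta : {lrmorphism A -> A}.

Lemma even_functional_odd (S : set A) (e : A) w x :
  state_on S e w -> even_on Theta S w -> S x -> Theta x = - x -> w x = 0.
Proof.
move=> [wlin _ _] we Sx ox.
have /eqP : w (- x) = w x by rewrite -ox; exact: we.
(* w is linear on S only through c *: x + y, whence this form of - x *)
have -> : - x = (- 2) *: x + x.
  by rewrite scaleNr scaler_nat mulr2n opprD addrNK.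
rewrite wlin// -subr_eq0 addrK mulf_eq0 oppr_eq0 pnatr_eq0/=.
by move=> /eqP.
Qed.

Variable a : int -> A.

(** One even factor suffices: it annihilates its odd argument. *)
Lemma product_state_odd (L1 L2 : set int) w x y :
  product_state a Theta L1 L2 w ->
  car_subalgebra a L1 x -> car_subalgebra a L2 y ->
  Theta x = - x -> Theta y = - y -> w (x * y) = 0.
Proof.
move=> [_ [w1 [w2 [sw1 sw2 ev wE]]]] L1x L2y ox oy; rewrite wE//.
case: ev => ev.
- by rewrite (even_functional_odd sw1 ev) ?mul0r.
- by rewrite (even_functional_odd sw2 ev) ?mulr0.
Qed.

(** Evaluation at z is continuous for pointwise convergence, so its kernel is
    closed. *)
Lemma closure_ptws_eq0 (P : set (A -> R[i])) (z : A) (w : A -> R[i]) :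
  (forall p, P p -> p z = 0) -> @closure {ptws A -> R[i]^o} P w -> w z = 0.
Proof.
move=> P0 clw.
pose Z := [set p : {ptws A -> R[i]^o} | p z = 0].
have clZ : closed Z.
  have -> : Z = (fun p : {ptws A -> R[i]^o} => p z) @^-1` [set (0 : R[i]^o)].
    by [].
  apply: preimage_closed.
    move=> p _; exact: (@proj_continuous A (fun _ => R[i]^o) z p).
  apply: accessible_closed_set1; apply: hausdorff_accessible.
  exact: norm_hausdorff.
by move: clw => /(@closureS {ptws A -> R[i]^o} P Z P0)/clZ.
Qed.

Lemma separable_state_odd (L1 L2 : set int) w x y :
  separable_state a Theta L1 L2 w ->
  car_subalgebra a L1 x -> car_subalgebra a L2 y ->
  Theta x = - x -> Theta y = - y -> w (x * y) = 0.
Proof.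
move=> sw L1x L2y ox oy.
apply: closure_ptws_eq0 sw => p [n [l [ps [_ _ hps ->]]]].
by apply: big1 => i _; rewrite (product_state_odd (hps i)) ?mulr0.
Qed.

End Entangled.

(** * Iterates of an automorphism and of its inverse *)

Section IntIter.
Context {R : realType} {A : cstarAlgType R}.
Variables (f : {lrmorphism A -> A}) (g : A -> A).
Hypotheses (fK : cancel f g) (gK : cancel g f).

Lemma int_iterM n : {morph int_iter f g n : x y / x * y}.
Proof.
have gM x y : g (x * y) = g x * g y.
  by apply: (can_inj fK); rewrite rmorphM/= !gK.
have iterM h m x y : {morph h : u v / u * v} ->
    iter m h (x * y) = iter m h x * iter m h y :> A.
  by move=> hM; elim: m => //= m ->.
by case: n => m x y; apply: iterM => //; exact: rmorphM.
Qed.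

Lemma int_iter_scalar n (c : R[i]) : int_iter f g n (c *: 1) = c *: 1.
Proof.
have fc : f (c *: 1) = c *: 1 by rewrite linearZ/= rmorph1.
have gc : g (c *: 1) = c *: 1 by rewrite -{1}fc fK.
by case: n => m; apply: iter_fix.
Qed.

End IntIter.

(** * Neighbouring sites on different sides *)

(** Otherwise membership in L1 would propagate from each site to both of its
    neighbours, L1 would be everything, and any point of L2 would have its
    left neighbour in L1. *)
Lemma adjacent_cover (L1 L2 : set int) :
  L1 !=set0 -> L2 !=set0 -> L1 `|` L2 = setT ->
  exists n, (L1 n /\ L2 (n + 1)) \/ (L2 n /\ L1 (n + 1)).
Proof.
move=> [i L1i] [j L2j] cov; apply: contrapT => /forallNP nadj.
have L12 n : L1 n \/ L2 n by have : [set: int] n by []; rewrite -cov.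
have up n : L1 n -> L1 (n + 1).
  by move=> L1n; case: (L12 (n + 1)) => // L2n; case: (nadj n); left.
have down n : L1 (n + 1) -> L1 n.
  by move=> L1n; case: (L12 n) => // L2n; case: (nadj n); right.
have L1D n (m : nat) : L1 n -> L1 (n + m%:Z).
  by move=> L1n; elim: m => [|m /up]; rewrite ?addr0// -addrA -PoszD addn1.
have L1B n (m : nat) : L1 n -> L1 (n - m%:Z).
  move=> L1n; elim: m => [|m IH]; first by rewrite subr0.
  by apply: down; rewrite -addn1 PoszD opprD addrA subrK.
have L1all n : L1 n.
  rewrite -(subrK i n) addrC; case: (n - i) => m; first exact: L1D.
  by rewrite NegzE; exact: L1B.
by apply: (nadj (j - 1)); left; split; [exact: L1all | rewrite subrK].
Qed.

(** * Off-diagonal two-by-two matrices *)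

Section Flip.
Context {R : realType}.
Implicit Types (Q T : 'M[R[i]]_2) (u v : 'cV[R[i]]_2).

Lemma adjmxM m n p (M : 'M[R[i]]_(m, n)) (N : 'M[R[i]]_(n, p)) :
  (M *m N) ^t* = N ^t* *m M ^t*.
Proof. by rewrite trmx_mul map_mxM. Qed.

(** The square matrix with columns u and v has orthonormal columns, hence also
    orthonormal rows. *)
Lemma orthonormal_resolution u v :
  u ^t* *m u = 1%:M -> v ^t* *m v = 1%:M -> u ^t* *m v = 0 ->
  rank_one u u + rank_one v v = 1.
Proof.
move=> uu vv uv.
have vu : v ^t* *m u = 0 by rewrite -[u]trmxCK -adjmxM uv trmx0 map_mx0.
pose U := row_mx u v.
have UU : U ^t* *m U = 1%:M.
  rewrite tr_row_mx map_col_mx mul_col_row uu vv uv vu.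
  exact: esym (scalar_mx_block _ _ _).
have : U *m U ^t* = 1%:M := @mulmx1C _ 2 _ _ UU.
by rewrite tr_row_mx map_col_mx mul_row_col.
Qed.

Lemma adj_rank_one u v : (rank_one u v) ^t* = rank_one v u.
Proof. by rewrite adjmxM trmxCK. Qed.

Lemma proj_range Q u : Q * Q = Q -> unit_vector_in_range Q u -> Q *m u = u.
Proof. by move=> QQ [[v ->] _]; rewrite mulmxA [Q *m Q]QQ. Qed.

Lemma adj_proj_range Q u : Q * Q = Q -> Q ^t* = Q ->
  unit_vector_in_range Q u -> u ^t* *m Q = u ^t*.
Proof. by move=> QQ Qs hu; rewrite -[in RHS](proj_range QQ hu) adjmxM Qs. Qed.

Lemma compl_idem Q : Q * Q = Q -> (1 - Q) * (1 - Q) = 1 - Q.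
Proof. by move=> QQ; rewrite mulrBl mul1r mulrBr mulr1 QQ subrr subr0. Qed.

(** Here Q T = Q T (1 - Q) maps the range of 1 - Q into that of Q, and in
    dimension two both ranges are the lines spanned by v and u, which leaves
    only a factor to choose. *)
Lemma flip_rank_one Q T u v : Q * Q = Q -> Q ^t* = Q ->
  unit_vector_in_range Q u -> unit_vector_in_range (1 - Q) v ->
  Q * T = T * (1 - Q) -> exists c : R[i], Q * T = c *: rank_one u v.
Proof.
move=> QQ Qs hu hv QT.
have QQc : Q * (1 - Q) = 0 by rewrite mulrBr mulr1 QQ subrr.
have uQ := adj_proj_range QQ Qs hu.
have vQ := proj_range (compl_idem QQ) hv.
have uv : u ^t* *m v = 0.
  by rewrite -uQ -vQ -mulmxA (mulmxA Q) [Q *m (1 - Q)]QQc mul0mx mulmx0.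
have res := orthonormal_resolution hu.2 hv.2 uv.
have Qu : Q = rank_one u u.
  rewrite -[LHS]mulr1 -res mulrDr {2}/rank_one.
  rewrite [Q * (v *m _)]mulmxA -{1}vQ mulmxA [Q *m (1 - Q)]QQc !mul0mx addr0.
  by rewrite [LHS]mulmxA (proj_range QQ hu).
have Qv : 1 - Q = rank_one v v by rewrite Qu -res addrC addKr.
exists ((u ^t* *m T *m v) 0 0).
have -> : Q * T = Q * T * (1 - Q) by rewrite QT -mulrA (compl_idem QQ).
transitivity (u *m (u ^t* *m T *m v) *m v ^t*).
  by rewrite Qv {1}Qu -[LHS]/(_ *m _ *m _) /rank_one !mulmxA.
by rewrite [u ^t* *m T *m v]mx11_scalar mul_mx_scalar -scalemxAl -mx11_scalar.
Qed.

End Flip.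

(** * Correlations of the Markov state *)

Section Correlation.
Context {R : realType} {A : cstarAlgType R} (a : int -> A).
Hypothesis hA : is_car_algebra a.
Variable Theta : {lrmorphism A -> A}.
Hypothesis hTheta : is_parity a Theta.
Variable alpha : {lrmorphism A -> A}.
Hypothesis halpha : is_shift a alpha.
Variable alphaV : A -> A.
Hypotheses (halphaV : cancel alpha alphaV) (halphaV' : cancel alphaV alpha).
Variable chi : R[i].
Hypothesis hchi : `|chi| = 1.

Notation maj := (majorana a).
Notation q := (qproj a chi).
Notation corner01 := (corner (car_subalgebra a [set (0 : int); 1]) q).

Lemma star1 : star (1 : A) = 1.
Proof. by rewrite -[LHS]mulr1 -{2}[1]starK -starM mulr1 starK. Qed.

Lemma star_majorana u j : star (maj u j) = maj u j.
Proof. by rewrite /majorana starD !starZ starK conjCK addrC. Qed.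

Lemma qproj_half : q = half_proj (maj chi 0).
Proof. by rewrite /qproj /half_proj addrA. Qed.

Lemma qprojN : qproj a (- chi) = 1 - q.
Proof.
by rewrite qproj_half -half_projN -majoranaN /qproj /half_proj addrA.
Qed.

Lemma star_qproj : star q = q.
Proof.
rewrite qproj_half /half_proj starZ starD star1 star_majorana.
by rewrite fmorphV rmorph_nat.
Qed.

Lemma qproj_idem : q * q = q.
Proof. by rewrite qproj_half half_proj_idem// majorana_sqr. Qed.

Lemma qproj_majorana : q * maj chi 0 * q = q.
Proof.
rewrite {1}qproj_half half_proj_mulr ?majorana_sqr//.
by rewrite -qproj_half qproj_idem.
Qed.

Lemma qproj_majorana_i : q * maj ('i * chi) 0 = maj ('i * chi) 0 * (1 - q).
Proof.
by rewrite qproj_half; apply: half_proj_anticomm; exact: majoranaM_i.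
Qed.

Lemma qproj_majorana1 u : q * maj u 1 = maj u 1 * (1 - q).
Proof.
by rewrite qproj_half; apply: half_proj_anticomm; exact: majoranaM_neq.
Qed.

Lemma majorana1_qproj u : maj u 1 * q = (1 - q) * maj u 1.
Proof.
by rewrite mulrBl mul1r qproj_majorana1 mulrBr mulr1 opprB addrC subrK.
Qed.

Lemma parity_majorana u j : Theta (maj u j) = - maj u j.
Proof.
have [[_ Tstar] Ta] := hTheta.
rewrite /majorana linearD !linearZ/= Ta Tstar Ta -scaleN1r starZ rmorphN1.
by rewrite !scaleN1r !scalerN opprD.
Qed.

Lemma shift_majorana u j : alpha (maj u j) = maj u (j + 1).
Proof.
have [[_ Tstar] Ta] := halpha.
by rewrite /majorana linearD !linearZ/= Ta Tstar Ta.
Qed.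

Lemma shift_iter_majorana u n j :
  int_iter alpha alphaV n (maj u j) = maj u (j + n).
Proof.
case: n => m /=.
  elim: m => [|m IH]; first by rewrite addr0.
  by rewrite iterS IH shift_majorana -addrA -PoszD addn1.
have down k : alphaV (maj u k) = maj u (k - 1).
  by rewrite -{1}(subrK 1 k) -shift_majorana halphaV.
rewrite NegzE; elim: m => [|m IH]; first by rewrite /= down.
by rewrite iterS IH down -addrA -opprD -PoszD addn1.
Qed.

Lemma odd_part_qproj : odd_part Theta q = 2^-1 *: maj chi 0.
Proof.
rewrite /odd_part qproj_half /half_proj linearZ/= rmorphD/= rmorph1.
rewrite parity_majorana -scalerBr opprD opprK addrACA subrr add0r.
by rewrite half_sum.
Qed.

Variable eta : A -> R[i].
Hypothesis heta : state_on corner01 q eta.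

Lemma qproj_corner : corner01 q.
Proof. by exists 1; [move=> B [[]] | rewrite mulr1 qproj_idem]. Qed.

Lemma eta0 : eta 0 = 0.
Proof.
have [elin _ _] := heta.
have := elin (-1) _ _ qproj_corner qproj_corner.
by rewrite scaleN1r addNr mulN1r addNr.
Qed.

Lemma etaZ c x : corner01 x -> eta (c *: x) = c * eta x.
Proof.
move=> Cx; have [elin _ _] := heta.
have C0 : corner01 0.
  exists 0; last by rewrite mulr0 mul0r.
  move=> B [[B1 Blin _ _ _] _]; rewrite -(subrr 1) addrC -scaleN1r.
  exact: Blin.
by have := elin c _ _ Cx C0; rewrite !addr0 eta0 addr0.
Qed.

(** Conjugation by q turns c_chi(0) into q, where eta is 1, so the result is
    q_chi - q_(-chi). *)
Lemma eps_majorana : eps a Theta chi eta (maj chi 0) = maj chi 0.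
Proof.
have [_ _ eta1] := heta.
rewrite /eps parity_majorana mulrN mulNr qproj_majorana -(scaleN1r q).
rewrite (etaZ (-1) qproj_corner).
rewrite eta1 mulr1 scale1r scaleN1r qprojN opprB addrA.
by rewrite qproj_half /half_proj -scalerDr half_sum addrAC subrr add0r.
Qed.

Lemma eps_even x : Theta x = x ->
  eps a Theta chi eta x = eta (q * x * q) *: 1.
Proof. by move=> ex; rewrite /eps ex qprojN -scalerDr addrC subrK. Qed.

Variables tau phi : A -> R[i].
Hypothesis htau : is_normalized_trace tau.
Hypothesis hphi : is_markov_state a Theta alpha alphaV chi eta tau phi.

(** The inner eps reproduces c_chi(n + 1), which leaves an even product as the
    argument of the outer one, and this becomes the scalar claimed. *)
Lemma markov_correlation n :
  phi (maj ('i * chi) n * maj chi (n + 1)) =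
  eta (q * (maj ('i * chi) 0 * maj chi 1) * q).
Proof.
pose x j := if j == n then maj ('i * chi) j else maj chi j.
have xn : x n = maj ('i * chi) n by rewrite /x eqxx.
have xn1 : x (n + 1) = maj chi (n + 1).
  by rewrite /x -[X in _ == X]addr0 (inj_eq (addrI n)).
have xcar j : car_subalgebra a [set j] (x j).
  by rewrite /x; case: ifP => _; exact: car_majorana.
have := hphi.2 x n 1 xcar.
rewrite !big_ord_recl big_ord0 mulr1/= addr0 xn xn1 => ->.
have nest1 : eps_at a Theta alpha alphaV chi eta (n + 1) (maj chi (n + 1)) =
    maj chi (n + 1).
  rewrite /eps_at shift_iter_majorana subrr eps_majorana.
  by rewrite shift_iter_majorana add0r.
rewrite nest1 /eps_at int_iterM// !shift_iter_majorana subrr addrAC subrr add0r.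
have [[taulin _ tau1] _] := htau.
rewrite eps_even; last by rewrite rmorphM/= !parity_majorana mulrNN.
rewrite int_iter_scalar//.
have tau0 : tau 0 = 0.
  by have := taulin (-1) 1 1 I I; rewrite scaleN1r addNr mulN1r addNr.
rewrite -[X in tau X]addr0 (taulin _ _ _ I I) tau0 tau1.
by rewrite addr0 mulr1.
Qed.

Variable iota : {lrmorphism 'M[R[i]]_2 -> A}.
Hypothesis hiota : mx2_isomorphism (car_subalgebra a [set (0 : int)]) iota.
Variable Q : 'M[R[i]]_2.
Hypothesis hQ : iota Q = q.
Variables xi xi' : 'cV[R[i]]_2.
Hypotheses (hxi : unit_vector_in_range Q xi)
  (hxi' : unit_vector_in_range (1 - Q) xi').
Notation V := (iota (rank_one xi' xi)).

Lemma Q_idem : Q * Q = Q.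
Proof.
by have [inj _ _] := hiota; apply: inj; rewrite rmorphM/= hQ qproj_idem.
Qed.

Lemma Q_adj : Q ^t* = Q.
Proof. by have [inj _ ad] := hiota; apply: inj; rewrite ad hQ star_qproj. Qed.

Lemma entanglerE W :
  entangler a Theta alpha chi W = 2^-1 *: (W * maj chi 1 * q).
Proof.
rewrite /entangler odd_part_qproj linearZ/= shift_majorana add0r.
by rewrite -(scalerAr _ W) -scalerAl.
Qed.

(** Moving the last factor q_chi to the left of the anticommuting c_chi(1)
    turns it into q_(-chi), whose range V = < . , xi > xi' annihilates. *)
Lemma entangler_annihilator : entangler a Theta alpha chi V = 0.
Proof.
have VqN : V * (1 - q) = 0.
  rewrite -hQ -(rmorph1 iota) -rmorphB -rmorphM/= -[rank_one _ _ * _]mulmxA.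
  rewrite -(adj_proj_range Q_idem Q_adj hxi) -mulmxA (_ : Q *m (1 - Q) = 0).
    by rewrite !mulmx0 rmorph0.
  by rewrite -[LHS]/(Q * (1 - Q)) mulrBr mulr1 Q_idem subrr.
by rewrite entanglerE -mulrA majorana1_qproj mulrA VqN mul0r scaler0.
Qed.

Lemma star_flip : star V = iota (rank_one xi xi').
Proof. by have [_ _ ad] := hiota; rewrite -ad adj_rank_one. Qed.

(** With q t = c V^*, the two quantities differ by the factor 2 c; and c = 0
    would give q = q t t = 0, against the existence of the unit vector xi. *)
Lemma correlation_entangler : eta (entangler a Theta alpha chi (star V)) != 0 ->
  eta (q * (maj ('i * chi) 0 * maj chi 1) * q) != 0.
Proof.
have [inj ran ad] := hiota.
have iota_car M : car_subalgebra a [set (0 : int)] (iota M).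
  by rewrite -ran; exists M.
have [T _ hT] : range iota (maj ('i * chi) 0).
  by rewrite ran; exact: car_majorana.
have QT : Q * T = T * (1 - Q).
  by apply: inj; rewrite !rmorphM rmorphB rmorph1/= hQ hT qproj_majorana_i.
have [c hc] := flip_rank_one Q_idem Q_adj hxi hxi' QT.
have qm : q * maj ('i * chi) 0 = c *: star V.
  by rewrite star_flip -hQ -hT -rmorphM/= hc linearZ.
have qV : q * star V = star V.
  by rewrite star_flip -hQ -rmorphM/= [Q * _]mulmxA (proj_range Q_idem hxi).
have CX : corner01 (star V * maj chi 1 * q).
  exists (star V * maj chi 1); last by rewrite mulrA qV.
  apply: car_subalgebraM.
    by rewrite star_flip; apply: car_subalgebraS (iota_car _) => j ->; left.
  by apply: car_majorana; right.
rewrite entanglerE etaZ// mulf_eq0 negb_or => /andP[_ eX].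
rewrite mulrA qm -!scalerAl etaZ// mulf_neq0//.
apply/eqP => c0; move: hxi.2.
have q0 : q = 0.
  have := majorana_sqr (u := 'i * chi) 0 hA.
  rewrite normrM normCi mul1r hchi => /(_ erefl) mm.
  by rewrite -[q]mulr1 -mm mulrA qm c0 scale0r mul0r.
have Q0 : Q = 0 by apply: inj; rewrite hQ q0 rmorph0.
rewrite -(proj_range Q_idem hxi) Q0 mul0mx mulmx0 => /matrixP/(_ 0 0)/eqP.
by rewrite !mxE eqxx eq_sym oner_eq0.
Qed.

End Correlation.

(** * Entanglement *)

Theorem proposition6p1 (R : realType) (A : cstarAlgType R) (a : int -> A)
    (hA : is_car_algebra a)
    (Theta : {lrmorphism A -> A}) (hTheta : is_parity a Theta)
    (alpha : {lrmorphism A -> A}) (halpha : is_shift a alpha)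
    (alphaV : A -> A) (halphaV : cancel alpha alphaV)
    (halphaV' : cancel alphaV alpha)
    (tau : A -> R[i]) (htau : is_normalized_trace tau)
    (chi : R[i]) (hchi : `|chi| = 1)
    (eta : A -> R[i])
    (heta : state_on
       (corner (car_subalgebra a [set (0 : int); 1]) (qproj a chi))
       (qproj a chi) eta)
    (heta_faithful : faithful_on
       (corner (car_subalgebra a [set (0 : int); 1]) (qproj a chi)) eta)
    (phi : A -> R[i])
    (hphi : is_markov_state a Theta alpha alphaV chi eta tau phi)
    (iota : {lrmorphism 'M[R[i]]_2 -> A})
    (hiota : mx2_isomorphism (car_subalgebra a [set (0 : int)]) iota)
    (Q : 'M[R[i]]_2) (hQ : iota Q = qproj a chi)
    (xi xi' : 'cV[R[i]]_2)
    (hxi : unit_vector_in_range Q xi)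
    (hxi' : unit_vector_in_range (1 - Q) xi')
    (V : A) (hV : V = iota (rank_one xi' xi))
    (L1 L2 : set int) (hL1 : L1 !=set0) (hL2 : L2 !=set0)
    (hdisj : L1 `&` L2 = set0) (hcover : L1 `|` L2 = setT)
    (hX : eta (entangler a Theta alpha chi V) != 0 \/
          eta (entangler a Theta alpha chi (star V)) != 0) :
  entangled_state a Theta L1 L2 phi.
Proof.
have corr n : phi (majorana a ('i * chi) n * majorana a chi (n + 1)) != 0.
  rewrite (markov_correlation hA hTheta halpha halphaV halphaV' hchi heta htau
    hphi).
  apply: (correlation_entangler hA hTheta halpha hchi heta hiota hQ hxi hxi').
  rewrite -hV; case: hX => //; rewrite hV.
  rewrite (entangler_annihilator hA hTheta halpha hchi hiota hQ xi' hxi).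
  by rewrite (eta0 hA hchi heta) eqxx.
have phi_lin := hphi.1.
split.
  by case: phi_lin => lin pos one; split=> // *; [exact: lin|exact: pos].
move=> sep; have odd := separable_state_odd sep.
have pm := parity_majorana hTheta.
have [n [[L1n L2n]|[L2n L1n]]] := adjacent_cover hL1 hL2 hcover.
  by move/eqP: (corr n); apply; apply: odd; rewrite ?pm//; exact: car_majorana.
(* the site n + 1 carries the factor in A_L1: the two factors anticommute *)
move/eqP: (corr n); apply.
have n1 : n != n + 1 by rewrite -[X in X != _]addr0 (inj_eq (addrI n)).
pose y := majorana a chi (n + 1) * majorana a ('i * chi) n.
have y0 : phi y = 0 by apply: odd; rewrite ?pm//; exact: car_majorana.
have [lin _ _] := phi_lin.
have := lin (- 2) y y I I; rewrite y0 mulr0 addr0 => <-; congr phi.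
by rewrite majoranaM_neq// scaleNr scaler_nat mulr2n opprD addrNK.
Qed.
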